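(* Let $F\subset\mathbb{R}^d$ be compact and suppose that $\hat F\subset[0,1]^d$ is a generalized fast tangent of $F$ whose box dimension exists, with $\dim_B\hat F=s$. Then $\dim_{qL}F\le s\le\dim_{qA}F$ whenever $\hat F$ contains an interior point of $[0,1]^d$.
   Context: $B(x,R)$ denotes the ball with centre $x$ and radius $R$ in $\mathbb{R}^d$. For bounded $A\subseteq\mathbb{R}^d$, $N_r(A)$ is the least number of balls of radius $r$ needed to cover $A$. The upper and lower box dimensions of a bounded set $E$ are $\overline{\dim}_BE=\limsup_{r\to0}\frac{\log N_r(E)}{-\log r}$ and $\underline{\dim}_BE=\liminf_{r\to0}\frac{\log N_r(E)}{-\log r}$; if they coincide the common value is the box dimension $\dim_BE$. For $0\le\delta<1$ let $\overline{h_E}(\delta)=\inf\{\alpha\ge0:\exists b,c>0$ such that $\max_{x\in E}N_r(E\cap B(x,R))\le c(R/r)^\alpha$ for all $0<r\le R^{1+\delta}\le R\le b\}$ and $\underline{h_E}(\delta)=\sup\{\alpha\ge0:\exists b,c>0$ such that $\min_{x\in E}N_r(E\cap B(x,R))\ge c(R/r)^\alpha$ for all $0<r\le R^{1+\delta}\le R\le b\}$. The quasi-Assouad dimension is $\dim_{qA}E=\lim_{\delta\to0}\overline{h_E}(\delta)$ and the quasi-lower Assouad dimension is $\dim_{qL}E=\lim_{\delta\to0}\underline{h_E}(\delta)$ (limits as $\delta\to0^+$ of monotone functions). The Hausdorff distance between compact sets $X,Y\subset\mathbb{R}^d$ is $\mathrm{dist}_H(X,Y)=\max\{p_H(X,Y),p_H(Y,X)\}$,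 where $p_H(X,Y)=\sup_{x\in X}\inf_{y\in Y}\|x-y\|$. Let $F\subset\mathbb{R}^d$ and $\hat F\subset[0,1]^d$ be compact. $\hat F$ is a generalized fast tangent of $F$ if there is a sequence of bi-Lipschitz maps $T_k:\mathbb{R}^d\to\mathbb{R}^d$ and constants $0<a_k\le b_k$ with $a_k\|x-y\|\le\|T_k(x)-T_k(y)\|\le b_k\|x-y\|$ for all $x,y\in\mathbb{R}^d$, $\sup_kb_k/a_k<\infty$, $\sup_kb_k=\infty$, $\mathrm{dist}_H(T_k(F)\cap[0,1]^d,\hat F)\to0$ as $k\to\infty$, and there are constants $C,\epsilon>0$ such that $\mathrm{dist}_H(T_k(F)\cap[0,1]^d,\hat F)\le Cb_k^{-\epsilon}$ for all $k$. *)

(* Defs.v *)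
From HB Require Import structures.
From mathcomp Require Import all_boot all_order all_algebra.
From mathcomp Require Import all_classical all_reals all_analysis.
Set Implicit Arguments.
Unset Strict Implicit.
Unset Printing Implicit Defensive.
Import Order.TTheory GRing.Theory Num.Theory.
Import numFieldNormedType.Exports.
Local Open Scope classical_set_scope.
Local Open Scope ring_scope.

(* R^d is 'rV[R]_d.  The library norm on row vectors is the sup norm, hence the
   explicit Euclidean norm; both induce the library topology. *)
Definition enorm (R : realType) (d : nat) (x : 'rV[R]_d) : R :=
  Num.sqrt (\sum_(i < d) x ord0 i ^+ 2).

Definition eball (R : realType) (d : nat) (x : 'rV[R]_d) (rho : R)
    : set 'rV[R]_d :=
  [set y | enorm (y - x) <= rho].

Definition covered_by (R : realType) (d : nat) (r : R) (A : set 'rV[R]_d)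
    (n : nat) : Prop :=
  exists c : 'I_n -> 'rV[R]_d, A `<=` \bigcup_(i in [set: 'I_n]) eball (c i) r.

(* N_r(A).  The minimum exists for bounded A and 0 < r; the default value 0 is
   taken when A has no finite cover by r-balls. *)
Definition covering_number (R : realType) (d : nat) (r : R)
    (A : set 'rV[R]_d) : nat :=
  xget 0%N [set n | covered_by r A n /\
                    forall m, covered_by r A m -> (n <= m)%N].

Definition upper_box_dim (R : realType) (d : nat) (E : set 'rV[R]_d) : \bar R :=
  limf_esup (fun r : R => (ln (covering_number r E)%:R / - ln r)%:E) 0^'+.

Definition lower_box_dim (R : realType) (d : nat) (E : set 'rV[R]_d) : \bar R :=
  limf_einf (fun r : R => (ln (covering_number r E)%:R / - ln r)%:E) 0^'+.

Definition has_box_dim (R : realType) (d : nat) (E : set 'rV[R]_d) (s : R)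
    : Prop :=
  upper_box_dim E = s%:E /\ lower_box_dim E = s%:E.

(* The bound on the maximum over x in E (below, on the minimum) is written as a
   bound for every x in E.  Meant for 0 <= delta < 1. *)
Definition h_upper (R : realType) (d : nat) (E : set 'rV[R]_d) (delta : R)
    : \bar R :=
  ereal_inf [set alpha%:E | alpha in [set alpha : R | 0 <= alpha /\
    exists b c : R, [/\ 0 < b, 0 < c &
      forall r rho : R, 0 < r -> r <= rho `^ (1 + delta) ->
        rho `^ (1 + delta) <= rho -> rho <= b ->
        forall x, E x ->
          (covering_number r (E `&` eball x rho))%:R
            <= c * (rho / r) `^ alpha]]].

Definition h_lower (R : realType) (d : nat) (E : set 'rV[R]_d) (delta : R)
    : \bar R :=
  ereal_sup [set alpha%:E | alpha in [set alpha : R | 0 <= alpha /\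
    exists b c : R, [/\ 0 < b, 0 < c &
      forall r rho : R, 0 < r -> r <= rho `^ (1 + delta) ->
        rho `^ (1 + delta) <= rho -> rho <= b ->
        forall x, E x ->
          c * (rho / r) `^ alpha
            <= (covering_number r (E `&` eball x rho))%:R]]].

Definition quasi_assouad_dim (R : realType) (d : nat) (E : set 'rV[R]_d)
    : \bar R :=
  lim (h_upper E delta @[delta --> 0^'+]).

Definition quasi_lower_assouad_dim (R : realType) (d : nat)
    (E : set 'rV[R]_d) : \bar R :=
  lim (h_lower E delta @[delta --> 0^'+]).

(* Extended-real valued, so that the distance from the empty set to a nonempty
   set is +oo. *)
Definition excess (R : realType) (d : nat) (X Y : set 'rV[R]_d) : \bar R :=
  ereal_sup [set ereal_inf [set (enorm (x - y))%:E | y in Y] | x in X].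

Definition dist_H (R : realType) (d : nat) (X Y : set 'rV[R]_d) : \bar R :=
  Order.max (excess X Y) (excess Y X).

Definition unit_cube (R : realType) (d : nat) : set 'rV[R]_d :=
  [set x | forall i, 0 <= x ord0 i <= 1].
Arguments unit_cube {R d}.

Definition generalized_fast_tangent (R : realType) (d : nat)
    (F hatF : set 'rV[R]_d) : Prop :=
  exists (T : nat -> 'rV[R]_d -> 'rV[R]_d) (a b : nat -> R),
    [/\ forall k, 0 < a k <= b k,
        forall k (x y : 'rV[R]_d), a k * enorm (x - y) <= enorm (T k x - T k y)
                        <= b k * enorm (x - y),
        (ereal_sup [set (b k / a k)%:E | k in [set: nat]] < +oo)%E /\
        ereal_sup [set (b k)%:E | k in [set: nat]] = +oo%E,
        dist_H (T k @` F `&` unit_cube) hatF @[k --> \oo] --> 0%E &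
        exists C eps : R, [/\ 0 < C, 0 < eps &
          forall k, (dist_H (T k @` F `&` unit_cube) hatF
                       <= (C * b k `^ (- eps))%:E)%E]].

(* Main.v *)
(** Put [u = 1 / b_k] and [rho = C u^eps].  Up to a bounded factor [T_k] scales
    distances by [1 / u], and at precision [rho] the sets [T_k F] and [hatF]
    are indistinguishable inside the cube.  Hence covering [hatF] at scale [rho]
    amounts to covering a piece of [F] of radius about [R = u] at scale about
    [r = rho u = C u^(1 + eps)], which is admissible in the definition of [h]
    for every [delta < eps] once [u] is small, and [R / r] is comparable to
    [1 / rho].  An exponent [al] of [F] thus bounds [N_rho(hatF)] by a multiple
    of [rho^-al] along scales [rho] tending to 0, which is enough because the
    box dimension of [hatF] exists.  For the lower bound the piece of [F] is
    taken around a point sent close to an interior point of the cube, so that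
    its image does not leave the cube. *)

Require Import Defs.
From HB Require Import structures.
From mathcomp Require Import all_boot all_order all_algebra finmap.
From mathcomp Require Import all_classical all_reals all_analysis.
From mathcomp Require Import ring lra.
Set Implicit Arguments.
Unset Strict Implicit.
Unset Printing Implicit Defensive.
Import Order.TTheory GRing.Theory Num.Theory.
Import numFieldNormedType.Exports.
Local Open Scope classical_set_scope.
Local Open Scope ring_scope.

(** * The Euclidean norm *)

Lemma enorm_ge0 (R : realType) (d : nat) (x : 'rV[R]_d) : 0 <= enorm x.
Proof. exact: sqrtr_ge0. Qed.

Lemma sqr_enorm (R : realType) (d : nat) (x : 'rV[R]_d) :
  enorm x ^+ 2 = \sum_(i < d) x ord0 i ^+ 2.
Proof. by rewrite sqr_sqrtr// sumr_ge0// => i _; rewrite sqr_ge0. Qed.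

Lemma enorm_distC (R : realType) (d : nat) (x y : 'rV[R]_d) :
  enorm (x - y) = enorm (y - x).
Proof.
congr Num.sqrt; apply: eq_bigr => i _.
by rewrite -opprB mxE sqrrN.
Qed.

Lemma coord_le_enorm (R : realType) (d : nat) (x : 'rV[R]_d) (i : 'I_d) :
  `|x ord0 i| <= enorm x.
Proof.
rewrite -sqrtr_sqr ler_wsqrtr// (bigD1 i)//= lerDl.
by rewrite sumr_ge0// => j _; rewrite sqr_ge0.
Qed.

(** Cauchy-Schwarz. With [a = enorm x] and [b = enorm y], the difference of the two sides times
    [a * b] is half the sum of the squares [(b x_i - a y_i)^2]; the cases [a = 0] and [b = 0] come
    first so that [a * b] can be cancelled. *)
Lemma ler_dot_enorm (R : realType) (d : nat) (x y : 'rV[R]_d) :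
  \sum_(i < d) x ord0 i * y ord0 i <= enorm x * enorm y.
Proof.
have [x0|x0] := eqVneq (enorm x) 0.
  rewrite x0 mul0r big1// => i _; apply/eqP; rewrite mulf_eq0 -normr_le0.
  by rewrite (le_trans (coord_le_enorm x i))// x0.
have [y0|y0] := eqVneq (enorm y) 0.
  rewrite y0 mulr0 big1// => i _; apply/eqP; rewrite mulf_eq0 orbC -normr_le0.
  by rewrite (le_trans (coord_le_enorm y i))// y0.
have xy_gt0 : 0 < enorm x * enorm y by rewrite mulr_gt0// lt0r enorm_ge0 ?x0 ?y0.
rewrite -(ler_pM2l xy_gt0) -subr_ge0.
suff -> : enorm x * enorm y * (enorm x * enorm y) -
    enorm x * enorm y * (\sum_(i < d) x ord0 i * y ord0 i) =
    2^-1 * \sum_(i < d) (enorm y * x ord0 i - enorm x * y ord0 i) ^+ 2.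
  by rewrite mulr_ge0 ?invr_ge0// sumr_ge0// => i _; rewrite sqr_ge0.
rewrite [X in _ = _ * X](eq_bigr (fun i => enorm y ^+ 2 * x ord0 i ^+ 2 +
  enorm x ^+ 2 * y ord0 i ^+ 2 -
  2 * (enorm x * enorm y) * (x ord0 i * y ord0 i))); last by move=> i _; ring.
rewrite sumrB big_split/= -!mulr_sumr -!sqr_enorm.
by field; exact: isT.
Qed.

Lemma ler_enormD (R : realType) (d : nat) (x y : 'rV[R]_d) :
  enorm (x + y) <= enorm x + enorm y.
Proof.
rewrite -(ler_pXn2r (n := 2))// ?nnegrE ?addr_ge0 ?enorm_ge0//.
rewrite sqrrD !sqr_enorm.
under eq_bigr => i _ do rewrite mxE sqrrD.
rewrite !big_split /= lerD2r lerD2l mulr2n.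
by rewrite lerD ?ler_dot_enorm.
Qed.

Lemma ler_enorm_dist (R : realType) (d : nat) (z x y : 'rV[R]_d) :
  enorm (x - y) <= enorm (x - z) + enorm (z - y).
Proof. by rewrite (le_trans _ (ler_enormD _ _))// addrA subrK. Qed.

(** The crude bound [d + 1] replaces the diameter [sqrt d]: it needs no root and stays positive when
    [d = 0]. *)
Lemma enorm_unit_cube (R : realType) (d : nat) (x y : 'rV[R]_d) :
  unit_cube x -> unit_cube y -> enorm (x - y) <= d%:R + 1.
Proof.
move=> xI yI; rewrite -(ler_pXn2r (n := 2))// ?nnegrE ?enorm_ge0 ?addr_ge0//.
rewrite sqr_enorm (@le_trans _ _ d%:R)//.
  rewrite -[leRHS]mulr1 mulr_natl -[X in _ *+ X](card_ord d) -sumr_const.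
  apply: ler_sum => i _; rewrite !mxE.
  move: (xI i) (yI i) => /andP[? ?] /andP[? ?]; nra.
by have := ler0n R d; nra.
Qed.

Lemma continuous_enorm (R : realType) (d : nat) (c : 'rV[R]_d) :
  continuous (fun x : 'rV[R]_d => enorm (x - c)).
Proof.
move=> x; apply: (@continuous_comp _ _ _
  (fun x : 'rV[R]_d => \sum_(i < d) (x - c) ord0 i ^+ 2) Num.sqrt); last first.
  exact: sqrt_continuous.
move: x; apply: (@continuous_big R _ +%R 0 xpredT _ 'rV[R]_d) => [|i _ x].
  exact: add_continuous.
under eq_fun => y do rewrite !mxE.
apply: (@continuous_comp _ _ _ ((fun y : 'rV[R]_d => y ord0 i) \- cst (c ord0 i))
  (fun u : R => u ^+ 2)); last exact: exprn_continuous.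
by apply: continuousB; [exact: coord_continuous|exact: cst_continuous].
Qed.

(** * Covering numbers *)

(** On compact sets this makes [covering_number] a true minimum rather than the default 0. The
    centres come from a finite subcover by open balls. *)
Lemma compact_covered_by (R : realType) (d : nat) (r : R) (A : set 'rV[R]_d) :
  0 < r -> compact A -> exists n, Defs.covered_by r A n.
Proof.
move=> r0; rewrite compact_cover.
move=> /(_ _ [set: 'rV[R]_d] (fun c => [set y | enorm (y - c) < r])).
case=> [c _||D _ AD].
- apply: (@open_comp _ _ (fun x : 'rV[R]_d => enorm (x - c)) [set u | u < r]).
    by move=> x _; exact: continuous_enorm.
  exact: open_lt.
- by move=> x Ax; exists x => //=; rewrite subrr /enorm big1 ?sqrtr0// => i _;
     rewrite mxE expr0n.
exists (size (enum_fset D)), (fun i => nth 0 (enum_fset D) i) => x Ax.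
have [c /= cD xc] := AD _ Ax.
have cD' : (index c (enum_fset D) < size (enum_fset D))%N by rewrite index_mem.
by exists (Ordinal cD') => //; rewrite /eball /= nth_index// ltW.
Qed.

Lemma covered_by_sub (R : realType) (d : nat) (r : R) (A B : set 'rV[R]_d) n :
  A `<=` B -> Defs.covered_by r B n -> Defs.covered_by r A n.
Proof. by move=> AB [c Bc]; exists c; exact: subset_trans AB Bc. Qed.

Lemma covering_numberP (R : realType) (d : nat) (r : R) (A : set 'rV[R]_d) n :
  Defs.covered_by r A n -> Defs.covered_by r A (covering_number r A) /\
    forall m, Defs.covered_by r A m -> (covering_number r A <= m)%N.
Proof.
move=> An; rewrite /covering_number.
suff /(xgetPex 0%N) : exists m, Defs.covered_by r A m /\
  forall k, Defs.covered_by r A k -> (m <= k)%N by [].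
have ex : exists m, `[< Defs.covered_by r A m >] by exists n; exact/asboolP.
exists (ex_minn ex); case: ex_minnP => m /asboolP Am mmin; split=> // k Ak.
exact/mmin/asboolP.
Qed.

Lemma covering_number_gt0 (R : realType) (d : nat) (r : R) (A : set 'rV[R]_d) n :
  A !=set0 -> Defs.covered_by r A n -> (0 < covering_number r A)%N.
Proof.
move=> [x Ax] /covering_numberP[+ _]; case: (covering_number r A) => // -[c Ac].
by have [[]] := Ac _ Ax.
Qed.

(** Two points of one [r]-ball are at most [2r] apart, so all points of [B] related to points of [A]
    in that ball lie within [r'] of any one of them, which serves as the new centre. A relation [P]
    is used because a tangent matches points only approximately. The cover by [n] balls excludes the
    default value of [covering_number r A]. *)
Lemma covering_number_correspondence (R : realType) (d : nat) (r r' : R)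
    (A B : set 'rV[R]_d) (P : 'rV[R]_d -> 'rV[R]_d -> Prop) n :
  (forall y, B y -> exists2 x, A x & P x y) ->
  (forall x x' y y', A x -> A x' -> P x y -> P x' y' ->
    enorm (x - x') <= r *+ 2 -> enorm (y - y') <= r') ->
  Defs.covered_by r A n -> (covering_number r' B <= covering_number r A)%N.
Proof.
move=> BA Plip /covering_numberP[[c Ac] _].
set N := covering_number r A in c Ac *.
suff BN : Defs.covered_by r' B N by have [_] := covering_numberP BN; exact.
pose Q i y := exists x, [/\ A x, eball (c i) r x & P x y].
(* If [Q i] is empty the centre is the arbitrary point 0; no point of [B] is assigned to such an
   [i]. *)
exists (fun i => xget 0 (Q i)) => y By.
have [x Ax Pxy] := BA _ By.
have [i _ xi] := Ac _ Ax.
exists i => //=.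
have /(xgetPex 0) [x' [Ax' xi' Px'y']] : exists y, Q i y by exists y, x.
apply: (Plip _ _ _ _ Ax Ax' Pxy Px'y').
rewrite (le_trans (ler_enorm_dist (c i) _ _))// mulr2n lerD//.
by rewrite enorm_distC.
Qed.

(** * Bounding box dimensions along a sequence of scales *)

(** A constant factor [K] in a covering number changes the quotient by [- ln r] by at most [e]. *)
Lemma near_ln_small (R : realType) (K e : R) : 0 < e ->
  \forall r \near 0^'+, [/\ 0 < r, r < 1 & `|ln K| <= e * - ln r].
Proof.
move=> e0; near=> r.
have r0 : 0 < r by near: r; exact: nbhs_right_gt.
have r1 : r < 1 by near: r; apply: nbhs_right_lt.
split=> //.
rewrite -ler_pdivrMl// lerNr -ler_expR lnK ?posrE//.
by near: r; apply: nbhs_right_le; exact: expR_gt0.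
Unshelve. all: by end_near. Qed.

(** A lower limit is bounded above by values at arbitrarily small scales; positivity of the covering
    numbers allows taking logarithms. *)
Lemma lower_box_dim_le (R : realType) (d : nat) (E : set 'rV[R]_d) (K al s : R) :
  lower_box_dim E = s%:E -> 0 < K ->
  (forall r, 0 < r -> (0 < covering_number r E)%N) ->
  (forall A, 0^'+ A -> exists2 r, A r &
    (covering_number r E)%:R <= K * r `^ (- al)) ->
  s <= al.
Proof.
move=> Es K0 N0 freq; apply/ler_addgt0Pr => e e0.
(* The lower limit is minus the upper limit of the opposite function, so one good scale in each [A]
   is enough. *)
rewrite -lee_fin -Es /lower_box_dim /limf_einf leeNl.
apply: le_ereal_inf_tmp => _ [A A0 <-].
have [r [Ar [r0 r1 Ke]] rK] := freq _ (filterI A0 (near_ln_small K e0)).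
apply: le_trans; last by apply: ereal_sup_ubound; exists r.
rewrite /= lee_fin lerN2 ler_pdivrMr ?oppr_gt0 ?ln_lt0 ?r0//.
move: rK; rewrite -ler_ln ?posrE ?mulr_gt0 ?powR_gt0 ?ltr0n ?N0//.
rewrite lnM ?posrE ?powR_gt0// ln_powR => /le_trans; apply.
by rewrite mulrDl mulNr -mulrN addrC lerD2l (le_trans _ Ke)// ler_norm.
Qed.

Lemma upper_box_dim_ge (R : realType) (d : nat) (E : set 'rV[R]_d) (K al s : R) :
  upper_box_dim E = s%:E -> 0 < K ->
  (forall A, 0^'+ A -> exists2 r, A r &
    K * r `^ (- al) <= (covering_number r E)%:R) ->
  al <= s.
Proof.
move=> Es K0 freq; apply/ler_addgt0Pr => e e0.
rewrite -lerBlDr -lee_fin -Es.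
apply: le_ereal_inf_tmp => _ [A A0 <-].
have [r [Ar [r0 r1 Ke]] rK] := freq _ (filterI A0 (near_ln_small K e0)).
apply: le_trans; last by apply: ereal_sup_ubound; exists r.
have Kr0 : 0 < K * r `^ (- al) by rewrite mulr_gt0 ?powR_gt0.
rewrite lee_fin ler_pdivlMr ?oppr_gt0 ?ln_lt0 ?r0//.
have N0 := lt_le_trans Kr0 rK; move: rK; rewrite -ler_ln//.
rewrite lnM ?posrE ?powR_gt0// ln_powR; apply: le_trans.
rewrite mulrBl mulNr -mulrN addrC lerD2r lerNl (le_trans _ Ke)//.
by rewrite -normrN ler_norm.
Qed.

(** * Monotonicity in [delta] and passage to the limit *)

Lemma admissible_scale_le1 (R : realType) (rho delta : R) :
  0 < delta -> 0 < rho -> rho `^ (1 + delta) <= rho -> rho <= 1.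
Proof.
move=> delta0 rho0; rewrite powRD ?gt_eqF ?addr_gt0//.
rewrite (powRr1 (ltW rho0)) ger_pMr// leNgt => rho_delta; rewrite leNgt.
apply: contra rho_delta => rho1.
have := gt0_ltr_powR delta0 _ _ rho1.
by rewrite powR1; apply; rewrite nnegrE// ltW.
Qed.

(** Since [rho <= 1], powers of [rho] decrease in the exponent. A larger [delta] thus admits fewer
    pairs of scales and allows more exponents, which gives the monotonicity of [h_upper] and
    [h_lower]. *)
Lemma admissible_scales_le (R : realType) (r rho x y : R) :
  0 < x -> x <= y -> 0 < r -> r <= rho `^ (1 + y) -> rho `^ (1 + y) <= rho ->
  r <= rho `^ (1 + x) /\ rho `^ (1 + x) <= rho.
Proof.
move=> x0 xy r0 rle yle.
have rho0 : 0 < rho by rewrite (lt_le_trans r0)// (le_trans rle).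
have rho1 : rho <= 1 by exact: admissible_scale_le1 (lt_le_trans x0 xy) rho0 yle.
split; first by rewrite (le_trans rle)// ger_powR ?rho0// lerD2l.
by rewrite ge1r_powR ?rho0// lerDl ltW.
Qed.

Lemma h_upper_nonincreasing (R : realType) (d : nat) (E : set 'rV[R]_d) :
  {in `]0, +oo[ &, {homo h_upper E : x y / x <= y >-> (y <= x)%E}}.
Proof.
move=> x y; rewrite !in_itv/= !andbT => x0 y0 xy.
apply: ereal_inf_le_tmp => _ [al [al0 [b [c [b0 c0 H]]]] <-].
exists al => //; split=> //; exists b, c; split=> // r rho r0 rle yle rhob.
by have [rle' xle] := admissible_scales_le x0 xy r0 rle yle; exact: H.
Qed.

Lemma h_lower_nondecreasing (R : realType) (d : nat) (E : set 'rV[R]_d) :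
  {in `]0, +oo[ &, {homo h_lower E : x y / x <= y >-> (x <= y)%E}}.
Proof.
move=> x y; rewrite !in_itv/= !andbT => x0 y0 xy.
apply: ereal_sup_le => _ [al [al0 [b [c [b0 c0 H]]]] <-].
exists al => //; split=> //; exists b, c; split=> // r rho r0 rle yle rhob.
by have [rle' xle] := admissible_scales_le x0 xy r0 rle yle; exact: H.
Qed.

(** Monotonicity makes the limit exist, so [lim] is the actual limit and inherits a bound valid for
    all small [delta]. *)
Lemma quasi_assouad_dim_ge (R : realType) (d : nat) (E : set 'rV[R]_d)
    (eps : R) (s : \bar R) : 0 < eps ->
  (forall delta, 0 < delta -> delta < eps -> (s <= h_upper E delta)%E) ->
  (s <= quasi_assouad_dim E)%E.
Proof.
move=> eps0 H; apply: lime_ge.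
  apply/cvg_ex; eexists.
  exact: (nonincreasing_at_right_cvge +oo%O isT (@h_upper_nonincreasing _ _ _)).
near=> delta; apply: H; near: delta; first exact: nbhs_right_gt.
exact: nbhs_right_lt.
Unshelve. all: by end_near. Qed.

Lemma quasi_lower_assouad_dim_le (R : realType) (d : nat) (E : set 'rV[R]_d)
    (eps : R) (s : \bar R) : 0 < eps ->
  (forall delta, 0 < delta -> delta < eps -> (h_lower E delta <= s)%E) ->
  (quasi_lower_assouad_dim E <= s)%E.
Proof.
move=> eps0 H; apply: lime_le.
  apply/cvg_ex; eexists.
  exact: (nondecreasing_at_right_cvge +oo%O isT (@h_lower_nondecreasing _ _ _)).
near=> delta; apply: H; near: delta; first exact: nbhs_right_gt.
exact: nbhs_right_lt.
Unshelve. all: by end_near. Qed.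

(** * Scales governed by the parameter [u] *)

(** For radius [P u] and covering scale [Q u^(1 + eps)], dividing by [u^(1 + delta)] reduces the
    first condition to [Q u^(eps - delta) <= P^(1 + delta)], true for small [u] because
    [delta < eps]. *)
Lemma near_admissible_scales (R : realType) (P Q b delta eps : R) :
  0 < P -> 0 < Q -> 0 < b -> 0 < delta -> delta < eps ->
  \forall u \near 0^'+, [/\ Q * u `^ eps * u <= (P * u) `^ (1 + delta),
    (P * u) `^ (1 + delta) <= P * u & P * u <= b].
Proof.
move=> P0 Q0 b0 delta0 delta_eps; near=> u.
have u0 : 0 < u by near: u; exact: nbhs_right_gt.
have Pu0 : 0 < P * u by rewrite mulr_gt0.
have Pu1 : P * u <= 1.
  rewrite -ler_pdivlMl//; near: u; apply: nbhs_right_le.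
  by rewrite mulr_gt0 ?invr_gt0.
split.
- rewrite powRM ?(ltW u0) ?(ltW P0)//.
  have -> : u `^ (1 + delta) = u `^ delta * u.
    by rewrite addrC powRD ?(gt_eqF u0) ?implybT// (powRr1 (ltW u0)).
  have -> : u `^ eps = u `^ (eps - delta) * u `^ delta.
    by rewrite -powRD ?subrK// (gt_eqF u0) implybT.
  rewrite !mulrA ler_pM2r// ler_pM2r ?powR_gt0// -ler_pdivlMl//.
  near: u; apply: (cvgr_le _ (powR_cvg0 _)); first by rewrite subr_gt0.
  by rewrite mulr_gt0 ?invr_gt0 ?powR_gt0.
- by rewrite ge1r_powR ?Pu0// lerDl ltW.
- rewrite -ler_pdivlMl//; near: u; apply: nbhs_right_le.
  by rewrite mulr_gt0 ?invr_gt0.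
Unshelve. all: by end_near. Qed.

Lemma powR_inv (R : realType) (x r : R) : 0 <= x -> x^-1 `^ r = (x `^ r)^-1.
Proof. by move=> x0; rewrite -(powR_inv1 x0) -powRrM mulN1r powRN. Qed.

Lemma near_scaled_powR (R : realType) (K eps : R) (A : set R) :
  0 < K -> 0 < eps -> 0^'+ A -> \forall u \near 0^'+, A (K * u `^ eps).
Proof.
move=> K0 eps0 [e /= e0 eA]; near=> u.
have u0 : 0 < u by near: u; exact: nbhs_right_gt.
have Ku0 : 0 < K * u `^ eps by rewrite mulr_gt0 ?powR_gt0.
apply: eA => //=; rewrite sub0r normrN gtr0_norm// -ltr_pdivlMl//.
near: u; apply: (cvgr_lt _ (powR_cvg0 eps0)).
by rewrite mulr_gt0 ?invr_gt0.
Unshelve. all: by end_near. Qed.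

(** * Fast tangents as approximate correspondences *)

Lemma excess_lt (R : realType) (d : nat) (X Y : set 'rV[R]_d) (e : R) x :
  (excess X Y < e%:E)%E -> X x -> exists2 y, Y y & enorm (x - y) <= e.
Proof.
move=> XY Xx.
have /ereal_inf_lt[_ [y Yy <-]] :
    (ereal_inf [set (enorm (x - y))%:E | y in Y] < e%:E)%E.
  by apply: le_lt_trans XY; apply: ereal_sup_ubound; exists x.
by rewrite lte_fin => /ltW; exists y.
Qed.

(* The parameter [u] is [(b k)^-1]. *)
Lemma fast_tangent_correspondence (R : realType) (d : nat)
    (F hatF : set 'rV[R]_d) : generalized_fast_tangent F hatF ->
  exists M C eps : R, [/\ 0 < M, 0 < C, 0 < eps &
    forall A : set R, 0^'+ A -> exists u (T : 'rV[R]_d -> 'rV[R]_d),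
      [/\ A u, 0 < u,
        forall x y, enorm (T x - T y) <= u^-1 * enorm (x - y) /\
                    enorm (x - y) <= M * u * enorm (T x - T y),
        forall x, F x -> unit_cube (T x) ->
          exists2 y, hatF y & enorm (T x - y) <= C * u `^ eps &
        forall y, hatF y -> exists x,
          [/\ F x, unit_cube (T x) & enorm (T x - y) <= C * u `^ eps]]].
Proof.
move=> [T [a [b [ab Tab [supba supb] _ [C [eps [C0 eps0 dist]]]]]]].
have b0 k : 0 < b k by case/andP: (ab k) => /lt_le_trans; exact.
have [M M0 bM] : exists2 M : R, 0 < M & forall k, b k <= M * a k.
  have ba0 k : 0 < b k / a k by case/andP: (ab k) => a0 _; rewrite divr_gt0.
  set S := ereal_sup _ in supba.
  have leS k : ((b k / a k)%:E <= S)%E by apply: ereal_sup_ubound; exists k.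
  have S_fin : S \is a fin_num.
    by rewrite ge0_fin_numE// (le_trans _ (leS 0%N))// lee_fin ltW.
  exists (fine S) => [|k].
    by rewrite -lte_fin fineK// (lt_le_trans _ (leS 0%N))// lte_fin.
  by have /andP[a0 _] := ab k; rewrite -ler_pdivrMr// -lee_fin fineK.
(* Doubling [C] makes the Hausdorff bound strict, so that [excess_lt] yields actual points although
   the infimum need not be attained. *)
exists M, (2 * C), eps; split=> //; first by rewrite mulr_gt0.
move=> A [e /= e0 eA].
(* As [b] is only known to be unbounded, [1 / b_k] is small for some [k], not for all large [k];
   this suffices for the box dimension lemmas. *)
have /ereal_sup_gt[_ [k _ <-]] :
    ((e^-1)%:E < ereal_sup [set (b k)%:E | k in [set: nat]])%E.
  by rewrite supb ltry.
rewrite lte_fin => ebk.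
have : (dist_H (T k @` F `&` unit_cube) hatF <
    (2 * C * (b k)^-1 `^ eps)%:E)%E.
  rewrite (le_lt_trans (dist k))// lte_fin powRN powR_inv ?(ltW (b0 k))//.
  rewrite ltr_pM2r ?invr_gt0 ?powR_gt0//.
  by rewrite ltr_pMl// ltr1n.
rewrite /dist_H gt_max => /andP[dist1 dist2].
exists (b k)^-1, (T k); split.
- apply: eA; last by rewrite invr_gt0.
  by rewrite /= sub0r normrN gtr0_norm ?invr_gt0// invf_plt ?posrE.
- by rewrite invr_gt0.
- move=> x y; rewrite invrK; have /andP[T1 T2] := Tab k x y; split=> //.
  have /andP[a0 _] := ab k.
  rewrite mulrAC ler_pdivlMr// (le_trans (ler_wpM2l (enorm_ge0 _) (bM k)))//.
  by rewrite mulrCA ler_pM2l// mulrC.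
- move=> x Fx Tx; apply: (excess_lt dist1).
  by split=> //; exists x.
- move=> y /(excess_lt dist2)[_ [[x Fx <-] Tx] xy].
  by exists x; split=> //; rewrite enorm_distC.
Qed.

(** * The two inequalities *)

Lemma box_dim_le_quasi_assouad_dim (R : realType) (d : nat)
    (F hatF : set 'rV[R]_d) (s : R) : compact F -> compact hatF ->
  generalized_fast_tangent F hatF -> hatF !=set0 ->
  lower_box_dim hatF = s%:E -> (s%:E <= quasi_assouad_dim F)%E.
Proof.
move=> compactF compact_hatF /fast_tangent_correspondence.
move=> [M [C [eps [M0 C0 eps0 tangent]]]] hatF0 dim_hatF.
apply: (quasi_assouad_dim_ge eps0) => delta delta0 delta_eps.
apply: le_ereal_inf_tmp => _ [al [al0 [b [c [b0 c0 count]]]] <-].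
rewrite lee_fin.
pose D : R := d%:R + 1.
have D0 : 0 < D by rewrite ltr_wpDl.
have DM0 : 0 < D * M by rewrite mulr_gt0.
apply: (@lower_box_dim_le _ _ hatF (c * (4 * (D * M)) `^ al)) => //.
- by rewrite mulr_gt0 ?powR_gt0 ?mulr_gt0.
- move=> r r0; have [n] := compact_covered_by r0 compact_hatF.
  exact: covering_number_gt0.
move=> A A0.
have C40 : 0 < 4 * C by rewrite mulr_gt0.
have [u [T [[Au [scale1 scale2 scale3]] u0 Tlip _ hatFF]]] := tangent _
  (filterI (near_scaled_powR C40 eps0 A0)
    (near_admissible_scales DM0 C0 b0 delta0 delta_eps)).
exists (4 * C * u `^ eps) => //.
have [z hatFz] := hatF0.
have [x0 [Fx0 Tx0 _]] := hatFF z hatFz.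
set rho := C * u `^ eps; have rho0 : 0 < rho by rewrite mulr_gt0 ?powR_gt0.
have r0 : 0 < rho * u by rewrite mulr_gt0.
have [n Fn] := compact_covered_by r0 compactF.
have cov : (covering_number (4 * C * u `^ eps) hatF <=
    covering_number (rho * u) (F `&` eball x0 (D * M * u)))%N.
  apply: (covering_number_correspondence
    (P := fun x y => enorm (T x - y) <= rho) (n := n)).
  (* The part of [F] sent into the cube has diameter at most [M u] times [D], whence the radius
     [D M u] around [x0]. *)
  - move=> y /hatFF[x [Fx Tx xy]]; exists x => //; split=> //=.
    have [_ /le_trans] := Tlip x x0; apply.
    rewrite (_ : D * M * u = M * u * D); last by ring.
    by rewrite ler_pM2l ?mulr_gt0// enorm_unit_cube.
  (* Points [2 rho u] apart have images [2 rho] apart, and each image is moved by at most [rho]: in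
     total [4 rho]. *)
  - move=> x x' y y' _ _ xy x'y' xx'.
    have [Txx' _] := Tlip x x'.
    rewrite (le_trans (ler_enorm_dist (T x) _ _))//.
    rewrite (enorm_distC y) -[leRHS]mulrA -/rho.
    have := ler_enorm_dist (T x') (T x) y'.
    have : u^-1 * enorm (x - x') <= 2 * rho.
      by rewrite ler_pdivrMl// (le_trans xx')// mulr2n; lra.
    by lra.
  - exact: covered_by_sub (@subIsetl _ _ _) Fn.
rewrite (@le_trans _ _ (c * (D * M * u / (rho * u)) `^ al))//.
  rewrite (le_trans _ (count _ _ r0 scale1 scale2 scale3 x0 Fx0))//.
  by rewrite ler_nat.
(* The factor [u] cancels, leaving a power of the scale [4 rho] at which [hatF] is tested. *)
rewrite (_ : D * M * u / (rho * u) = 4 * (D * M) * (4 * rho)^-1); last first.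
  by field; rewrite !gt_eqF.
have DM4 : 0 <= 4 * (D * M) by rewrite mulr_ge0// ltW.
have rho4 : 0 <= 4 * rho by rewrite mulr_ge0// ltW.
by rewrite powRM ?invr_ge0// powR_inv// powRN /rho !mulrA.
Qed.

(** The correspondence runs the other way, from a cover of [hatF] to one of a piece of [F]; every
    image of that piece must then lie in the cube, where it has a nearby point of [hatF]. *)
Lemma quasi_lower_assouad_dim_le_box_dim (R : realType) (d : nat)
    (F hatF : set 'rV[R]_d) (s : R) : compact hatF ->
  generalized_fast_tangent F hatF -> hatF `&` unit_cube° !=set0 ->
  upper_box_dim hatF = s%:E -> (quasi_lower_assouad_dim F <= s%:E)%E.
Proof.
move=> compact_hatF /fast_tangent_correspondence.
move=> [M [C [eps [M0 C0 eps0 tangent]]]] [z [hatFz]] + dim_hatF.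
rewrite /interior => /nbhs_ballP[e /= e0 ze_cube].
(* Coordinates are bounded by the Euclidean norm, so the sup-norm ball of radius [e] contains the
   Euclidean one. *)
have z_cube y : enorm (y - z) < e -> unit_cube y.
  move=> yz; apply: ze_cube; split=> // i j; rewrite /= ord1.
  rewrite /ball/= distrC (le_lt_trans _ yz)//.
  by have := coord_le_enorm (y - z) j; rewrite !mxE.
apply: (quasi_lower_assouad_dim_le eps0) => delta delta0 delta_eps.
apply: ge_ereal_sup => _ [al [al0 [b [c [b0 c0 count]]]] <-].
rewrite lee_fin.
have e30 : 0 < e / 3 by rewrite divr_gt0.
have C4M0 : 0 < 4 * C * M by rewrite !mulr_gt0.
apply: (@upper_box_dim_ge _ _ hatF (c * (e / 3 / (4 * M)) `^ al)) => //.
  by rewrite mulr_gt0 ?powR_gt0 ?divr_gt0 ?mulr_gt0.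
move=> A A0.
have [u [T [[[Au ue] [scale1 scale2 scale3]] u0 Tlip FhatF hatFF]]] := tangent _
  (filterI (filterI (near_scaled_powR C0 eps0 A0)
      (near_scaled_powR C0 eps0 (nbhs_right_lt e30)))
    (near_admissible_scales e30 C4M0 b0 delta0 delta_eps)).
exists (C * u `^ eps) => //.
have [x0 [Fx0 _ Tx0z]] := hatFF z hatFz.
move: Au ue Tx0z FhatF scale1.
rewrite (_ : 4 * C * M * _ * u = 4 * M * (C * u `^ eps) * u); last by ring.
have : 0 < C * u `^ eps by rewrite mulr_gt0 ?powR_gt0.
move: (C * u `^ eps) => rho rho0 Arho rho_e Tx0z FhatF scale1.
have [n hatFn] := compact_covered_by rho0 compact_hatF.
have cov : (covering_number (4 * M * rho * u) (F `&` eball x0 (e / 3 * u)) <=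
    covering_number rho hatF)%N.
  apply: (covering_number_correspondence
    (P := fun y x => enorm (T x - y) <= rho) (n := n)) => //.
  (* [T x] is within [e / 3] of [T x0], which is within [rho < e / 3] of [z]; so [T x] stays in the
     cube. *)
  - move=> x [Fx xx0]; apply: FhatF => //; apply: z_cube.
    have [Txx0 _] := Tlip x x0.
    have := ler_enorm_dist (T x0) (T x) z.
    have : u^-1 * enorm (x - x0) <= e / 3 by rewrite ler_pdivrMl// mulrC.
    have : e / 3 * 3 = e by field.
    lra.
  (* Here [T x] and [T x'] are at most [rho + 2 rho + rho] apart, and pulling back by [T] costs the
     factor [M u]. *)
  - move=> y y' x x' _ _ xy x'y' yy'.
    have [_ /le_trans] := Tlip x x'; apply.
    rewrite (_ : 4 * M * rho * u = M * u * (4 * rho)); last by ring.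
    rewrite ler_pM2l ?mulr_gt0//.
    have := ler_enorm_dist y (T x) (T x').
    have := ler_enorm_dist y' y (T x').
    rewrite (enorm_distC y' (T x')); move: yy'; rewrite mulr2n; lra.
have r0 : 0 < 4 * M * rho * u by rewrite !mulr_gt0.
move: cov; rewrite -(ler_nat R); apply: le_trans.
apply: le_trans (count _ _ r0 scale1 scale2 scale3 x0 Fx0).
rewrite powRN -mulrA -powR_inv ?(ltW rho0)//.
rewrite -powRM ?invr_ge0 ?(ltW rho0) ?divr_ge0 ?mulr_ge0 ?(ltW e0) ?(ltW M0)//.
rewrite le_eqVlt; apply/orP; left; apply/eqP; congr (_ * _ `^ al); field.
by rewrite !gt_eqF.
Qed.

Theorem corollary7 (R : realType) (d : nat) (F hatF : set 'rV[R]_d) (s : R)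
  (compactF : compact F)
  (compact_hatF : compact hatF)
  (hatF_cube : hatF `<=` unit_cube)
  (tangent : generalized_fast_tangent F hatF)
  (box_dim_hatF : has_box_dim hatF s)
  (interior_pt : hatF `&` unit_cube° !=set0) :
  (quasi_lower_assouad_dim F <= s%:E /\ s%:E <= quasi_assouad_dim F)%E.
Proof.
have [upper_dim lower_dim] := box_dim_hatF; split.
  exact: quasi_lower_assouad_dim_le_box_dim compact_hatF _ _ _.
apply: (box_dim_le_quasi_assouad_dim compactF compact_hatF) => //.
by case: interior_pt => z [hatFz _]; exists z.
Qed.
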